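(* Let $n\ge 6$ and $k\ge 3$ be integers. Then $$\mathrm{sat}^{lin}_k(n,\text{Berge-}C_3)= \bigg\lfloor\frac{n-1}{k-1}\bigg\rfloor.$$
   Context: A hypergraph $H=(V(H),E(H))$ is $k$-uniform if every hyperedge is a $k$-element subset of $V(H)$, and linear if any two distinct hyperedges share at most one vertex. A Berge cycle Berge-$C_\ell$ of length $\ell$ in $H$ is an alternating sequence $(v_1,e_1,v_2,e_2,\dots,v_\ell,e_\ell)$ of distinct vertices $v_i$ and distinct hyperedges $e_i$ of $H$ with $v_i,v_{i+1}\in e_i$ for $1\le i\le \ell-1$ and $v_\ell,v_1\in e_\ell$. A linear $k$-uniform hypergraph $H$ is linear Berge-$C_t$-saturated if $H$ contains no Berge-$C_t$, but for every $e\in\binom{V(H)}{k}\setminus E(H)$ such that $H+e$ is still linear, $H+e$ contains a Berge-$C_t$. The linear saturation number $\mathrm{sat}^{lin}_k(n,\text{Berge-}C_t)$ is the minimum number of hyperedges of an $n$-vertex linear $k$-uniform hypergraph that is linear Berge-$C_t$-saturated. *)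

(* Defs.v *)
From mathcomp Require Import all_boot.

Set Implicit Arguments.
Unset Strict Implicit.
Unset Printing Implicit Defensive.

(* A hypergraph on the finite vertex type V is its set of hyperedges, of type
   {set {set V}}; vertices lying in no hyperedge are allowed. *)

Section Hypergraph.

Variable V : finType.
Implicit Types (E : {set {set V}}) (e f : {set V}).

Definition uniform (k : nat) E : bool := [forall e in E, #|e| == k].

Definition linear E : bool :=
  [forall e in E, forall f in E, (e != f) ==> (#|e :&: f| <= 1)].

(* ordS is the cyclic successor on 'I_t, so the case i = t - 1 of the last
   condition is the one closing the cycle. *)
Definition berge_cycle (t : nat) E
    (v : {ffun 'I_t -> V}) (c : {ffun 'I_t -> {set V}}) : bool :=
  [&& injectiveb v, injectiveb c, [forall i, c i \in E]
    & [forall i, (v i \in c i) && (v (ordS i) \in c i)]].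

Definition has_berge (t : nat) E : bool :=
  [exists v : {ffun 'I_t -> V}, exists c : {ffun 'I_t -> {set V}},
    berge_cycle E v c].

Definition lin_berge_saturated (k t : nat) E : bool :=
  [&& uniform k E, linear E, ~~ has_berge t E
    & [forall e : {set V},
        [&& #|e| == k, e \notin E & linear (e |: E)] ==>
          has_berge t (e |: E)]].

Lemma lin_berge_saturated_exists (k t : nat) :
  0 < t -> exists E, lin_berge_saturated k t E.
Proof.
move=> t_gt0.
pose P E := [&& uniform k E, linear E & ~~ has_berge t E].
have P0 : P set0.
  apply/and3P; split.
  - by apply/forall_inP=> e; rewrite inE.
  - by apply/forall_inP=> e; rewrite inE.
  apply/existsP=> -[v /existsP[c /and4P[_ _ /forallP/(_ (Ordinal t_gt0))]]].
  by rewrite inE.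
case: (arg_maxnP (fun E : {set {set V}} => #|E|) P0) => E /and3P[uE lE bE] maxE.
exists E; apply/and4P; split=> //.
apply/forallP=> e; apply/implyP=> /and3P[ek eE leE].
apply: contraT => beE.
have /maxE : P (e |: E).
  apply/and3P; split=> //.
  by apply/forall_inP=> f /setU1P[-> //|]; apply: (forall_inP uE).
by rewrite /= cardsU1 eE add1n leqNgt leqnn.
Qed.

End Hypergraph.

(* The vertex set is 'I_n.  The default value set0 of the minimum is returned
   only when no saturated hypergraph exists, which happens for no t > 0: see
   sat_linP. *)
Definition sat_lin (k n t : nat) : nat :=
  #|[arg min_(E < (set0 : {set {set 'I_n}}) | lin_berge_saturated k t E) #|E| ]|.

Lemma sat_linP (k n t : nat) : 0 < t ->
  (exists2 E : {set {set 'I_n}}, lin_berge_saturated k t E & #|E| = sat_lin k n t)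
  /\ (forall E : {set {set 'I_n}}, lin_berge_saturated k t E ->
        sat_lin k n t <= #|E|).
Proof.
move=> /(lin_berge_saturated_exists 'I_n k)[E0 sE0].
rewrite /sat_lin /arg_min /extremum.
case: pickP => [E /andP[sE /forall_inP minE] | no] /=.
  by split; [exists E | move=> F /minE].
case: (arg_minnP (fun E : {set {set 'I_n}} => #|E|) sE0) => E sE minE.
have /= := no E; rewrite sE /= => /negP[].
by apply/forall_inP=> F /minE.
Qed.

(* Main.v *)
Require Import Defs.
From mathcomp Require Import all_boot.
From mathcomp Require Import zify.

(** Upper bound: [(n - 1) %/ (k - 1)] edges of size [k] sharing exactly one
    vertex leave at most [k - 2] vertices uncovered, so every further edge
    meeting each of them at most once avoids the center and meets two of them
    off the center, which closes a triangle.

    Lower bound: each edge merges at most [k] connected components into one, so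
    a hypergraph with [m] edges has at least [n - m * (k - 1)] components.  An
    edge with its vertices in [k] different components never closes a cycle,
    hence a saturated hypergraph has at most [k - 1] components and
    [n <= (m + 1) * (k - 1)]. *)

(** * Berge triangles, and the lower bound by component labels *)

Section Triangles.

Set Implicit Arguments.
Unset Strict Implicit.

Variable V : finType.
Implicit Types (E : {set {set V}}) (e : {set V}).

(** Trades the cyclic indexing by ['I_3] for named vertices and edges, so that both bounds can build
    or refute a triangle directly. *)
Lemma has_berge3P E :
  reflect (exists x y z : V, exists a b c : {set V},
    [/\ [&& x != y, y != z & z != x], [&& a != b, b != c & c != a],
        [&& a \in E, b \in E & c \in E]
      & [&& x \in a, y \in a, y \in b, z \in b, z \in c & x \in c]])
    (has_berge 3 E).
Proof.
have o0 (i : 'I_3) : [\/ i = inord 0, i = inord 1 | i = inord 2].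
  case: i => [[|[|[|//]]] lti]; [constructor 1 | constructor 2 | constructor 3];
    by apply: val_inj; rewrite /= inordK.
have oS0 : ordS (inord 0 : 'I_3) = inord 1 by apply: val_inj; rewrite /= !inordK.
have oS1 : ordS (inord 1 : 'I_3) = inord 2 by apply: val_inj; rewrite /= !inordK.
have oS2 : ordS (inord 2 : 'I_3) = inord 0 by apply: val_inj; rewrite /= !inordK.
apply: (iffP existsP) => [[v /existsP[c]] | [x [y [z [a [b [c]]]]]]].
  case/and4P=> /injectiveP injv /injectiveP injc /forallP cE /forallP vc.
  exists (v (inord 0)), (v (inord 1)), (v (inord 2)).
  exists (c (inord 0)), (c (inord 1)), (c (inord 2)).
  have := vc (inord 0); have := vc (inord 1); have := vc (inord 2).
  rewrite oS0 oS1 oS2 => /andP[-> ->] /andP[-> ->] /andP[-> ->].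
  by rewrite !(inj_eq injv) !(inj_eq injc) !cE -!val_eqE /= !inordK.
case=> /and3P[xy yz zx] /and3P[ab bc ca] /and3P[aE bE cE].
case/and5P=> xa ya yb zb /andP[zc xc].
pose pick3 T (t0 t1 t2 : T) :=
  [ffun i : 'I_3 => if i == 0 :> nat then t0 else if i == 1 :> nat then t1 else t2].
have p0 T (t0 t1 t2 : T) : pick3 T t0 t1 t2 (inord 0) = t0.
  by rewrite ffunE inordK.
have p1 T (t0 t1 t2 : T) : pick3 T t0 t1 t2 (inord 1) = t1.
  by rewrite ffunE inordK.
have p2 T (t0 t1 t2 : T) : pick3 T t0 t1 t2 (inord 2) = t2.
  by rewrite ffunE inordK.
have inj3 (T : eqType) (t0 t1 t2 : T) :
    t0 != t1 -> t1 != t2 -> t2 != t0 -> injective (pick3 T t0 t1 t2).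
  move=> /eqP n01 /eqP n12 /eqP n20 i j.
  by case: (o0 i) => ->; case: (o0 j) => ->; rewrite ?p0 ?p1 ?p2 // => /esym.
exists (pick3 V x y z); apply/existsP; exists (pick3 {set V} a b c).
apply/and4P; split; first exact/injectiveP/inj3.
- exact/injectiveP/inj3.
- by apply/forallP=> i; case: (o0 i) => ->; rewrite ?p0 ?p1 ?p2.
apply/forallP=> i.
by case: (o0 i) => ->; rewrite ?oS0 ?oS1 ?oS2 ?p0 ?p1 ?p2; apply/andP.
Qed.

Lemma linear_eq E e f x y :
  linear E -> e \in E -> f \in E -> x \in e -> x \in f -> y \in e -> y \in f ->
  x != y -> e = f.
Proof.
move=> lE eE fE xe xf ye yf xy; apply/eqP.
have /implyP lef := forall_inP (forall_inP lE e eE) f fE.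
apply: contraT => /lef; rewrite leqNgt => /negP[].
by apply/card_gt1P; exists x, y; rewrite !inE xe xf ye yf.
Qed.

(** [f] stands in for the map to connected components: constancy on edges and a count of values
    suffice, so no paths are needed. Induction on the number of edges. *)
Lemma component_labelling k E :
  0 < k -> uniform k E ->
  exists2 f : V -> V,
    forall e, e \in E -> {in e &, forall x y, f x = f y}
    & #|V| <= #|f @: setT| + #|E| * (k - 1).
Proof.
move=> k_gt0; move: {2}#|E| (erefl #|E|) => m.
elim: m E => [|m IHm] E cardE uE.
  exists id => [e|]; first by rewrite (cards0_eq cardE) inE.
  by rewrite imset_id cardsT leq_addr.
have [e eE] : exists e, e \in E by apply/card_gt0P; rewrite cardE.
have /eqP ek := forall_inP uE e eE.
have [x xe] : exists x, x \in e by apply/card_gt0P; rewrite ek.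
have cardE' : #|E :\ e| = m by apply/eqP; rewrite -eqSS -cardE (cardsD1 e E) eE.
have [|f fE cardf] := IHm _ cardE'.
  by apply/forall_inP=> g /setD1P[_]; apply: (forall_inP uE).
(* Putting [e] back merges all labels seen on [e] into that of [x]. *)
pose h y := if f y \in f @: e then f x else f y.
exists h => [g gE y z yg zg|].
  have [eqge|neqge] := eqVneq g e.
    by rewrite /h !imset_f // -eqge.
  have fyz : f y = f z by apply: (fE g) => //; rewrite !inE neqge.
  by rewrite /h fyz.
(* Only labels of [e] other than [f x] can disappear, hence at most [k - 1] of them. *)
have sub : f @: setT \subset h @: setT :|: (f @: e) :\ f x.
  apply/subsetP=> _ /imsetP[y _ ->]; rewrite !inE.
  have [fxy|_] := eqVneq (f y) (f x).
    by rewrite orbF; apply/imsetP; exists x; rewrite // fxy /h; case: ifP.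
  rewrite /=; have [|fye] := boolP (f y \in f @: e); first by rewrite orbT.
  by rewrite orbF; apply/imsetP; exists y; rewrite // /h (negPf fye).
have := leq_trans (subset_leq_card sub) (leq_card_setU _ _).1.
have := leq_imset_card f e; rewrite (cardsD1 (f x)) imset_f // ek.
by rewrite cardE; move: cardf; rewrite cardE'; nia.
Qed.

Lemma saturated_card k E :
  1 < k -> lin_berge_saturated k 3 E -> #|V| <= (#|E|).+1 * (k - 1).
Proof.
move=> k_gt1 /and4P[uE lE bE /forallP satE].
have [f fE cardf] := component_labelling (ltnW k_gt1) uE.
suff : #|f @: setT| < k by nia.
rewrite ltnNge; apply/negP => lekf.
(* With [k] labels available, choosing one vertex per label yields the candidate edge [e], on which
   [f] is injective. *)
have [S subS cardS] : exists2 S : {set V}, S \subset f @: setT & #|S| = k.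
  have : 0 < #|[set S : {set V} | S \subset f @: setT & #|S| == k]|.
    by rewrite cards_draws bin_gt0.
  by case/card_gt0P=> S; rewrite inE => /andP[subS /eqP]; exists S.
have fpre s : s \in S -> exists x, f x == s.
  by move=> /(subsetP subS)/imsetP[x _ ->]; exists x.
(* By [fpre] the default is never returned on [S]. *)
pose g s := odflt s [pick x | f x == s].
have gK : {in S, cancel g f}.
  move=> s /fpre[x fx]; rewrite /g; case: pickP => [y /eqP //|/(_ x)].
  by rewrite fx.
pose e := g @: S.
have fe : {in e &, injective f}.
  by move=> _ _ /imsetP[s sS ->] /imsetP[t tS ->]; rewrite !gK // => ->.
have ek : #|e| = k.
  by rewrite card_in_imset // => s t sS tS est; rewrite -(gK s) // est gK.
have meet1 d : d \in E -> #|e :&: d| <= 1.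
  move=> dE; rewrite leqNgt; apply/negP => /card_gt1P[x [y []]].
  rewrite !inE => /andP[xe xd] /andP[ye yd] /eqP[].
  by apply: fe => //; apply: fE dE _ _ xd yd.
have eE : e \notin E by apply/negP => /meet1; rewrite setIid ek leqNgt k_gt1.
have leE : linear (e |: E).
  apply/forall_inP=> a aE; apply/forall_inP=> b bE'; apply/implyP.
  case/setU1P: aE bE' => [->|aE] /setU1P[->|bE']; rewrite ?eqxx // => neq.
  - exact: meet1.
  - by rewrite setIC meet1.
  - by have /forall_inP/(_ b bE')/implyP := forall_inP lE a aE; apply.
have := satE e; rewrite ek eqxx eE leE /= => /has_berge3P.
(* The two edges of the triangle other than [e] give the same label to two
   distinct vertices of [e]. *)
have step x y z (b c : {set V}) : b \in E -> c \in E ->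
    y \in b -> z \in b -> z \in c -> x \in c -> x \in e -> y \in e -> x = y.
  move=> bE' cE yb zb zc xc xe ye; apply: fe => //.
  by rewrite (fE c cE x z) // (fE b bE' z y).
move=> [x [y [z [a [b [c [/and3P[xy yz zx] /and3P[ab bc ca]]]]]]]].
case/and3P=> aE bE' cE /and5P[xa ya yb zb /andP[zc xc]].
have inE' d : d \in e |: E -> d != e -> d \in E by case/setU1P=> // -> /eqP.
(* Whichever edge of the triangle is [e], [step] applies to the other two after a rotation; if none
   is, the triangle already lies in [E]. *)
have [eqa|na] := eqVneq a e.
  move: ab ca xa ya; rewrite eqa eq_sym => nb nc xe ye.
  by move: xy; rewrite (step x y z b c) ?eqxx // inE'.
have [eqb|nb] := eqVneq b e.
  move: bc yb zb; rewrite eqb eq_sym => nc ye ze.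
  by move: yz; rewrite (step y z x c a) ?eqxx // inE'.
have [eqc|nc] := eqVneq c e.
  move: zc xc; rewrite eqc => ze xe.
  by move: zx; rewrite (step z x y a b) ?eqxx // inE'.
case/negP: bE; apply/has_berge3P; exists x, y, z, a, b, c.
by rewrite xy yz zx ab bc ca xa ya yb zb zc xc !inE'.
Qed.

End Triangles.

(** * The star, and the upper bound *)

Section Star.

Set Implicit Arguments.
Unset Strict Implicit.

Variables (n k : nat).
Hypothesis k_gt1 : 1 < k.

Let m := n %/ (k - 1).

(* The center is [ord0]; the [n] other vertices are cut into consecutive blocks
   of length [k - 1]. *)
Definition star_edge (j : nat) : {set 'I_n.+1} :=
  [set x : 'I_n.+1 | (x == ord0) || ((x - 1) %/ (k - 1) == j)].

Definition star : {set {set 'I_n.+1}} := [set star_edge j | j : 'I_m].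

Lemma star_edge_lt (j : 'I_m) (i : 'I_(k - 1)) : j * (k - 1) + i < n.
Proof.
apply: leq_trans (leq_divM n (k - 1)); rewrite -/m.
by have := ltn_ord j; have := ltn_ord i; nia.
Qed.

Lemma card_star_edge (j : 'I_m) : #|star_edge j| = k.
Proof.
(* Enumerates the [j]-th block; the successor skips the center. *)
pose g (i : 'I_(k - 1)) : 'I_n.+1 := inord (j * (k - 1) + i).+1.
have gE i : g i = (j * (k - 1) + i).+1 :> nat by rewrite inordK // ltnS star_edge_lt.
have -> : star_edge j = ord0 |: g @: setT.
  apply/setP=> x; rewrite !inE; have [//|x0 /=] := eqVneq x ord0.
  apply/eqP/imsetP => [xj|[i _ ->]].
    have lti : (x - 1) %% (k - 1) < k - 1 by rewrite ltn_mod subn_gt0.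
    exists (Ordinal lti) => //; apply: val_inj; rewrite /= gE /= -xj -divn_eq.
    by move: x0; rewrite -val_eqE /=; lia.
  by rewrite gE subn1 /= divnMDl ?subn_gt0 // divn_small ?addn0.
rewrite cardsU1 card_imset => [|i i' /(congr1 val)].
  rewrite cardsT card_ord; case: imsetP => [[i _ /(congr1 val)]|_ /=].
    by rewrite /= gE.
  by lia.
by rewrite /= !gE => -[/addnI/val_inj].
Qed.

Lemma star_edge_meet (i j : nat) x :
  x != ord0 -> x \in star_edge i -> x \in star_edge j -> i = j.
Proof. by move=> x0; rewrite !inE (negPf x0) => /eqP-> /eqP. Qed.

(** Since [k > 1], an edge has a vertex off the center, and that vertex determines its block. *)
Lemma star_edge_inj : injective (fun j : 'I_m => star_edge j).
Proof.
move=> i j eqij.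
have : 1 < #|star_edge i| by rewrite card_star_edge.
rewrite (cardsD1 ord0) inE /= => /card_gt0P[x]; rewrite in_setD1 => /andP[x0 xi].
by apply/val_inj/(star_edge_meet x0 xi); rewrite -eqij.
Qed.

Lemma card_star : #|star| = m.
Proof. by rewrite card_imset ?card_ord //; apply: star_edge_inj. Qed.

Lemma star_meet (a b : {set 'I_n.+1}) x :
  a \in star -> b \in star -> a != b -> x \in a -> x \in b -> x = ord0.
Proof.
move=> /imsetP[i _ ->] /imsetP[j _ ->] neq xi xj; apply/eqP.
by apply: contraT => x0; rewrite (star_edge_meet x0 xi xj) eqxx in neq.
Qed.

(** The full blocks cover [1] to [m * (k - 1)]; what is left is the remainder of [n] modulo
    [k - 1]. *)
Lemma card_uncovered : #|[set x : 'I_n.+1 | m * (k - 1) < x]| < k - 1.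
Proof.
have k1 : 0 < k - 1 by rewrite subn_gt0.
have sub : #|[set x : 'I_n.+1 | m * (k - 1) < x]| <= n - m * (k - 1).
  have subI : [set x : 'I_n.+1 | m * (k - 1) < x] \subset
      [set inord (m * (k - 1) + i).+1 | i : 'I_(n - m * (k - 1))].
    apply/subsetP=> x; rewrite inE => ltx.
    have lti : x - (m * (k - 1)).+1 < n - m * (k - 1).
      by have := ltn_ord x; lia.
    apply/imsetP; exists (Ordinal lti) => //; apply: val_inj => /=.
    by rewrite -addSn subnKC // inordK.
  apply: leq_trans (subset_leq_card subI) _.
  by apply: leq_trans (leq_imset_card _ _) _; rewrite card_ord.
apply: leq_ltn_trans sub _.
by rewrite {1}(divn_eq n (k - 1)) -/m addKn ltn_mod.
Qed.

Lemma star_saturated : lin_berge_saturated k 3 star.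
Proof.
apply/and4P; split.
- by apply/forall_inP=> _ /imsetP[j _ ->]; rewrite card_star_edge.
- apply/forall_inP=> a aE; apply/forall_inP=> b bE; apply/implyP=> neq.
  rewrite leqNgt; apply/negP => /card_gt1P[x [y []]].
  rewrite !inE => /andP[xa xb] /andP[ya yb] /eqP[].
  by rewrite (star_meet aE bE neq xa xb) (star_meet aE bE neq ya yb).
(* Both [y] and [z] lie in two distinct edges, so both would be the center. *)
- apply/has_berge3P=> -[x [y [z [a [b [c [/and3P[_ yz _]]]]]]]].
  case/and3P=> ab bc _ /and3P[aE bE cE] /and5P[_ ya yb zb /andP[zc _]].
  by move: yz; rewrite (star_meet aE bE ab ya yb) (star_meet bE cE bc zb zc) eqxx.
apply/forallP=> e; apply/implyP=> /and3P[/eqP ek eE leE].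
have starW a : a \in star -> a \in e |: star by move=> aE; rewrite inE aE orbT.
have ee : e \in e |: star by rewrite setU11.
have meet1 (j : 'I_m) x y : x \in e -> y \in e ->
    x \in star_edge j -> y \in star_edge j -> x = y.
  move=> xe ye xj yj; apply/eqP; apply: contraNT eE => xy.
  have jE : star_edge j \in star by apply: imset_f.
  by rewrite (linear_eq leE ee (starW _ jE) xe xj ye yj xy).
pose U := [set x : 'I_n.+1 | m * (k - 1) < x].
have cover x : x \in e :\: U -> x != ord0 -> exists j : 'I_m, x \in star_edge j.
  rewrite !inE -leqNgt => /andP[xm _] x0.
  have ltj : (x - 1) %/ (k - 1) < m.
    by rewrite ltn_divLR ?subn_gt0 //; move: x0; rewrite -val_eqE /=; lia.
  by exists (Ordinal ltj); rewrite inE /= eqxx orbT.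
have big : 1 < #|e :\: U|.
  have leI : #|e :&: U| < k - 1.
    exact: leq_ltn_trans (subset_leq_card (subsetIr e U)) card_uncovered.
  by rewrite -(ltn_add2l #|e :&: U|) cardsID ek; lia.
have [x [y [xeU yeU xy]]] := card_gt1P big.
have [xe ye] : x \in e /\ y \in e by move: xeU yeU => /setDP[-> _] /setDP[-> _].
(* If [e] held the center, it would share both the center and a covered vertex with one star edge,
   against [meet1]. *)
have center (z t : 'I_n.+1) :
    z \in e :\: U -> z \in e -> t \in e -> t = ord0 -> z != t -> False.
  move=> zU ze te t0; rewrite t0 => z0; have [j zj] := cover z zU z0.
  by case/eqP: z0; apply: (meet1 j) => //; rewrite -?t0 // inE t0 eqxx.
have x0 : x != ord0.
  by apply/eqP => x0; apply: center yeU ye xe x0 _; rewrite eq_sym.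
have y0 : y != ord0 by apply/eqP => y0; apply: center xeU xe ye y0 xy.
have [i xi] := cover x xeU x0; have [j yj] := cover y yeU y0.
have iE : star_edge i \in star by apply: imset_f.
have jE : star_edge j \in star by apply: imset_f.
(* The two star edges differ, as otherwise [meet1] would identify [x] and [y]. *)
apply/has_berge3P; exists ord0, x, y, (star_edge i), e, (star_edge j).
rewrite eq_sym x0 xy y0 xe ye xi yj ee !starW // !inE eqxx; split=> //.
apply/and3P; split; first by apply: contraNneq eE => <-.
  by apply: contraNneq eE => ->.
by apply: contraNneq xy => eqji; rewrite (meet1 j x y) // eqji.
Qed.

End Star.

Theorem theorem1p3 (n k : nat) (hn : 6 <= n) (hk : 3 <= k) :
  sat_lin k n 3 = (n - 1) %/ (k - 1).
Proof.
have k_gt1 : 1 < k by lia.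
case: n hn => [//|n] _; rewrite subn1 /=.
have [[E satE <-] minE] := sat_linP k n.+1 (isT : 0 < 3).
apply/eqP; rewrite eqn_leq -{1}(card_star n k_gt1) minE ?star_saturated //=.
(* Here [n] is the predecessor of the vertex count, so the bound of [saturated_card] is the strict
   inequality [n < (#|E|).+1 * (k - 1)]. *)
rewrite -ltnS ltn_divLR ?subn_gt0 //.
by have := saturated_card k_gt1 satE; rewrite card_ord.
Qed.
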